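(* Let $n\ge 2$ and $k\ge 0$ be integers, let $\mathfrak h_{2n+1}$ be the real Heisenberg Lie algebra of dimension $2n+1$, and let $\nabla$ be the Bismut connection associated to any abelian balanced Hermitian structure $(J,F)$ on $\mathfrak h_{2n+1}\times\mathbb R^{2k+1}$. Then $\mathfrak{hol}(\nabla)=\mathfrak u(1)$, i.e. $\mathfrak{hol}(\nabla)$ is the one-dimensional Lie algebra.
   Context: $\mathfrak h_{2n+1}$ has a basis $e_1,\dots,e_{2n},z_0$ whose only non-zero brackets (up to skew-symmetry) are $[e_{2i-1},e_{2i}]=z_0$, $i=1,\dots,n$; $\mathbb R^{2k+1}$ is abelian. A complex structure on a real Lie algebra $\mathfrak g$ is a linear map $J$ with $J^2=-\mathrm{Id}$ and $[JX,JY]-J[JX,Y]-J[X,JY]-[X,Y]=0$; it is abelian if $[JX,JY]=[X,Y]$ for all $X,Y$. A Hermitian structure on $\mathfrak g$, $\dim\mathfrak g=2N$, is a pair $(J,g)$ with $J$ a complex structure and $g$ an inner product with $g(JX,JY)=g(X,Y)$, equivalently denoted $(J,F)$ with $F(X,Y)=g(X,JY)$. It is balanced if $d(F^{N-1})=0$, $d$ being the Chevalley-Eilenberg differential ($d\alpha(X,Y)=-\alpha([X,Y])$ for $\alpha\in\mathfrak g^*$). $(J,F)$ is abelian balanced if $J$ is abelian and $F$ is balanced. Bismut connection: with $2g(\nabla^g_XY,Z)=g([X,Y],Z)-g([Y,Z],X)+g([Z,X],Y)$ (Levi-Civita) and $T(X,Y,Z)=-dF(JX,JY,JZ)$, the Bismut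 connection is the bilinear map $\nabla:\mathfrak g\times\mathfrak g\to\mathfrak g$ with $g(\nabla_XY,Z)=g(\nabla^g_XY,Z)+\frac12T(X,Y,Z)$, viewed as a left-invariant connection on a Lie group with Lie algebra $\mathfrak g$. $\mathfrak{hol}(\nabla)$ is the Lie algebra of its (restricted) holonomy group; by Ambrose-Singer it is generated by the curvature endomorphisms $R(X,Y)=[\nabla_X,\nabla_Y]-\nabla_{[X,Y]}$ and their covariant derivatives of all orders. *)

(* Defs.v *)
From HB Require Import structures.
From mathcomp Require Import all_boot all_order all_fingroup all_algebra.
From mathcomp Require Import all_classical all_reals.
Set Implicit Arguments.
Unset Strict Implicit.
Unset Printing Implicit Defensive.
Import Order.TTheory GRing.Theory Num.Theory.
Local Open Scope ring_scope.

Record lieAlgebra (R : realType) := LieAlgebra {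
  lie_space :> vectType R;
  lie_br : lie_space -> lie_space -> lie_space;
  lie_linearl : forall y, linear (lie_br^~ y);
  lie_linearr : forall x, linear (lie_br x);
  lie_alt : forall x, lie_br x x = 0;
  lie_jacobi : forall x y z,
    lie_br x (lie_br y z) + lie_br y (lie_br z x) + lie_br z (lie_br x y) = 0
}.
Arguments lie_br {R l} _ _.

Section LieAlgebras.
Variable R : realType.

Section Product.
Variables L M : lieAlgebra R.

Definition prod_br (x y : (L * M)%type) : (L * M)%type :=
  (lie_br x.1 y.1, lie_br x.2 y.2).

Fact prod_br_linearl y : linear (prod_br^~ y).
Proof. by move=> a u v; rewrite /prod_br /= !lie_linearl. Qed.

Fact prod_br_linearr x : linear (prod_br x).
Proof. by move=> a u v; rewrite /prod_br /= !lie_linearr. Qed.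

Fact prod_br_alt x : prod_br x x = 0.
Proof. by rewrite /prod_br !lie_alt. Qed.

Fact prod_br_jacobi x y z :
  prod_br x (prod_br y z) + prod_br y (prod_br z x) + prod_br z (prod_br x y)
  = 0.
Proof. by congr pair; apply: lie_jacobi. Qed.

Definition prod_lie : lieAlgebra R :=
  LieAlgebra prod_br_linearl prod_br_linearr prod_br_alt prod_br_jacobi.

End Product.

Section Abelian.
Variable m : nat.

Definition abelian_br (x y : 'rV[R]_m) : 'rV[R]_m := 0.

Fact abelian_br_linearl y : linear (abelian_br^~ y).
Proof. by move=> a u v; rewrite /abelian_br scaler0 addr0. Qed.

Fact abelian_br_linearr x : linear (abelian_br x).
Proof. by move=> a u v; rewrite /abelian_br scaler0 addr0. Qed.

Fact abelian_br_alt x : abelian_br x x = 0.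
Proof. by []. Qed.

Fact abelian_br_jacobi x y z :
  abelian_br x (abelian_br y z) + abelian_br y (abelian_br z x)
  + abelian_br z (abelian_br x y) = 0.
Proof. by rewrite /abelian_br !addr0. Qed.

Definition abelian_lie : lieAlgebra R :=
  LieAlgebra abelian_br_linearl abelian_br_linearr abelian_br_alt
    abelian_br_jacobi.

End Abelian.

Section Heisenberg.
Variable n : nat.
Local Notation V := 'rV[R]_(n.*2.+1).

(* Coordinates are numbered from 0: the basis vectors e_(2i-1), e_(2i)        *)
(* (1 <= i <= n) and z_0 of the usual presentation are the unit vectors of    *)
(* index 2(i-1), 2(i-1)+1 and 2n respectively.                                *)
Definition heis_odd (i : 'I_n) : 'I_(n.*2.+1) := inord i.*2.
Definition heis_even (i : 'I_n) : 'I_(n.*2.+1) := inord i.*2.+1.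
Definition heis_e (j : 'I_(n.*2.+1)) : V := delta_mx 0 j.
Definition heis_z0 : V := delta_mx 0 ord_max.

Definition heis_br (x y : V) : V :=
  (\sum_(i < n) (x 0 (heis_odd i) * y 0 (heis_even i)
               - x 0 (heis_even i) * y 0 (heis_odd i))) *: heis_z0.

Lemma heis_oddE (i : 'I_n) : heis_odd i = i.*2 :> nat.
Proof. by rewrite inordK // ltnS leq_double ltnW. Qed.

Lemma heis_evenE (i : 'I_n) : heis_even i = i.*2.+1 :> nat.
Proof. by rewrite inordK // ltnS ltn_double. Qed.

Lemma heis_br_e (i j : 'I_n) :
  [/\ heis_br (heis_e (heis_odd i)) (heis_e (heis_even j))
        = (i == j)%:R *: heis_z0,
      heis_br (heis_e (heis_odd i)) (heis_e (heis_odd j)) = 0 &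
      heis_br (heis_e (heis_even i)) (heis_e (heis_even j)) = 0].
Proof.
have oo (a b : 'I_n) : (heis_odd a == heis_odd b) = (a == b).
  apply/eqP/eqP => [|-> //] /(congr1 val); rewrite /= !heis_oddE => /double_inj.
  exact: val_inj.
have ee (a b : 'I_n) : (heis_even a == heis_even b) = (a == b).
  apply/eqP/eqP => [|-> //] /(congr1 val); rewrite /= !heis_evenE => -[].
  by move/double_inj; apply: val_inj.
have oe (a b : 'I_n) : (heis_odd a == heis_even b) = false.
  apply/eqP => /(congr1 (odd \o val)) /=.
  by rewrite heis_oddE heis_evenE /= !odd_double.
have eo (a b : 'I_n) : (heis_even a == heis_odd b) = false.
  by rewrite eq_sym oe.
split; rewrite /heis_br.
- congr (_ *: _); rewrite (bigD1 i) //= big1 ?addr0 => [|l /negPf li].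
    by rewrite !mxE /= !eqxx /= ee oe eo !mul0r subr0 mul1r.
  by rewrite !mxE /= oo eo li !mul0r subr0.
- rewrite big1 ?scale0r // => l _.
  by rewrite !mxE /= !eo mulr0 mul0r subr0.
- rewrite big1 ?scale0r // => l _.
  by rewrite !mxE /= !oe mulr0 mul0r subr0.
Qed.

Lemma heis_br_z0 x : heis_br x heis_z0 = 0.
Proof.
rewrite /heis_br big1 ?scale0r // => i _; rewrite !mxE /=.
have -> : (heis_even i == ord_max) = false.
  apply/eqP => /(congr1 (odd \o val)) /=.
  by rewrite heis_evenE /= !odd_double.
have -> : (heis_odd i == ord_max) = false.
  apply/eqP => /(congr1 val) /=; rewrite heis_oddE => /double_inj ein.
  by have := ltn_ord i; rewrite ein ltnn.
by rewrite !mulr0 subr0.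
Qed.

Fact heis_br_linearr x : linear (heis_br x).
Proof.
move=> a u v; rewrite /heis_br scalerA -scalerDl; congr (_ *: _).
rewrite mulr_sumr -big_split /=; apply: eq_bigr => i _.
by rewrite !mxE !mulrDr mulrN opprD addrACA !(mulrCA a).
Qed.

Fact heis_br_skew x y : heis_br x y = - heis_br y x.
Proof.
rewrite /heis_br -scaleNr -sumrN; congr (_ *: _); apply: eq_bigr => i _.
by rewrite opprB ![y _ _ * _]mulrC.
Qed.

Fact heis_br_linearl y : linear (heis_br^~ y).
Proof.
by move=> a u v; rewrite /= !(heis_br_skew _ y) heis_br_linearr opprD scalerN.
Qed.

Fact heis_br_alt x : heis_br x x = 0.
Proof.
rewrite /heis_br big1 ?scale0r // => i _.
by rewrite [x _ (heis_even i) * _]mulrC subrr.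
Qed.

Fact heis_br_jacobi x y z :
  heis_br x (heis_br y z) + heis_br y (heis_br z x) + heis_br z (heis_br x y)
  = 0.
Proof.
have brZ u v w : heis_br u (heis_br v w) = 0.
  rewrite [heis_br v w]/heis_br -[_ *: heis_z0]addr0 heis_br_linearr.
  rewrite heis_br_z0 scaler0 add0r.
  by rewrite /heis_br big1 ?scale0r // => i _; rewrite !mxE !mulr0 subr0.
by rewrite !brZ !addr0.
Qed.

Definition heisenberg_lie : lieAlgebra R :=
  LieAlgebra heis_br_linearl heis_br_linearr heis_br_alt heis_br_jacobi.

End Heisenberg.
End LieAlgebras.

Section Forms.
Variables (R : realType) (L : lieAlgebra R).

(* Exterior forms are represented by their values on families of vectors;     *)
(* the forms built below from a Hermitian structure are indeed alternating    *)
(* and multilinear.                                                           *)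
Definition ext_form (p : nat) := {ffun 'I_p -> L} -> R.

Definition wedge p q (a : ext_form p) (b : ext_form q) : ext_form (p + q) :=
  fun x =>
  (p`!%:R * q`!%:R)^-1 *
  \sum_(s : 'S_(p + q)) (-1) ^+ s *
    (a [ffun i => x (s (lshift q i))] * b [ffun i => x (s (rshift p i))]).

Fixpoint wedge_pow p (a : ext_form p) (m : nat) : ext_form (m * p) :=
  if m is m'.+1 then wedge a (@wedge_pow p a m') else fun=> 1.

(* ([x_i, x_j], x_0, .., ^x_i, .., ^x_j, .., x_(p+1)) for i < j.              *)
Definition ce_args p (x : {ffun 'I_p.+2 -> L}) (i : 'I_p.+1) (j : 'I_p.+2) :
    {ffun 'I_p.+1 -> L} :=
  [ffun t => if unlift ord0 t is Some t' then x (lift j (lift i t'))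
             else lie_br (x (lift j i)) (x j)].

(* Chevalley-Eilenberg differential, trivial coefficients:                    *)
(* sum over i < j of (-1)^(i+j) a([x_i,x_j], x_0, .., ^x_i, .., ^x_j, ..).    *)
Definition ce_diff p : ext_form p -> ext_form p.+1 :=
  match p with
  | 0 => fun _ _ => 0
  | p'.+1 => fun a x =>
      \sum_(j < p'.+2) \sum_(i < p'.+1 | (i < j)%N)
        (-1) ^+ (i + j) * a (ce_args x i j)
  end.

Definition pair_of (x y : L) : {ffun 'I_2 -> L} :=
  [ffun i => tnth [tuple x; y] i].
Definition triple_of (x y z : L) : {ffun 'I_3 -> L} :=
  [ffun i => tnth [tuple x; y; z] i].

End Forms.
Arguments wedge_pow {R L p} a m _.

Lemma ce_diff1E (R : realType) (L : lieAlgebra R) (a : ext_form L 1) (x y : L) :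
  ce_diff a (pair_of x y) = - a [ffun=> lie_br x y].
Proof.
rewrite /= big_ord_recl big_pred0 // add0r big_ord1.
rewrite big_mkcond big_ord1 /= expr1 mulN1r; congr (- a _).
apply/ffunP=> t; rewrite !ffunE [t]ord1 unlift_none.
by congr lie_br; rewrite (tnth_nth 0).
Qed.

Lemma ce_diff2E (R : realType) (L : lieAlgebra R) (a : ext_form L 2)
    (x y z : L) :
  ce_diff a (triple_of x y z) =
    - a (pair_of (lie_br x y) z) + a (pair_of (lie_br x z) y)
    - a (pair_of (lie_br y z) x).
Proof.
rewrite /= big_ord_recl big_pred0 // add0r big_ord_recl big_ord1.
rewrite big_mkcond [X in _ + X]big_mkcond /= !big_ord_recl !big_ord0 /=.
rewrite !addr0 add0n expr1 -signr_odd expr0 mul1r.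
rewrite -signr_odd expr1 !mulN1r addrA.
congr (- a _ + a _ - a _); apply/ffunP=> t; rewrite !ffunE;
  case: unliftP => [t'|] -> /=; rewrite ?ffunE !(tnth_nth 0) /= ?[t']ord1 //=.
Qed.

Section Hermitian.
Variables (R : realType) (L : lieAlgebra R).
Implicit Types (J : 'End(L)) (g : {dot L for idfun}).

Definition complex_structure J :=
  (forall x, J (J x) = - x) /\
  (forall x y, lie_br (J x) (J y) - J (lie_br (J x) y) - J (lie_br x (J y))
               - lie_br x y = 0).

Definition abelian_structure J :=
  complex_structure J /\ forall x y, lie_br (J x) (J y) = lie_br x y.

Definition hermitian_structure J g :=
  complex_structure J /\ forall x y, g (J x) (J y) = g x y.

Definition fundamental_form J g : ext_form L 2 :=
  fun x => g (x (inord 0)) (J (x (inord 1))).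

(* d(F^(N-1)) = 0, where dim L = 2N.                                          *)
Definition balanced J g :=
  forall x, ce_diff (wedge_pow (fundamental_form J g) (\dim {:L})./2.-1) x = 0.

Definition abelian_balanced J g :=
  [/\ hermitian_structure J g, abelian_structure J & balanced J g].

Definition levi_civita g (D : 'Hom(L, 'End(L))) :=
  forall x y z, 2 * g (D x y) z =
    g (lie_br x y) z - g (lie_br y z) x + g (lie_br z x) y.

Definition bismut_torsion J g (x y z : L) : R :=
  - ce_diff (fundamental_form J g) (triple_of (J x) (J y) (J z)).

Definition bismut_connection J g (D : 'Hom(L, 'End(L))) :=
  exists2 D0, levi_civita g D0 &
    forall x y z, g (D x y) z = g (D0 x y) z + 2^-1 * bismut_torsion J g x y z.

End Hermitian.

Section Holonomy.
Variables (R : realType) (L : lieAlgebra R).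

Definition end_br (A B : 'End(L)) : 'End(L) := (A \o B)%VF - (B \o A)%VF.

Definition lie_subalgebra (H : {vspace 'End(L)}) :=
  forall A B, A \in H -> B \in H -> end_br A B \in H.

Definition generated_by (S : set 'End(L)) (H : {vspace 'End(L)}) :=
  [/\ lie_subalgebra H, forall A, S A -> A \in H &
      forall H', lie_subalgebra H' -> (forall A, S A -> A \in H') ->
        (H <= H')%VS].

Definition lie_generated (S : set 'End(L)) : {vspace 'End(L)} :=
  xget fullv (generated_by S).

Lemma lie_generatedP (S : set 'End(L)) : generated_by S (lie_generated S).
Proof.
pose P (H : {vspace 'End(L)}) :=
  lie_subalgebra H /\ forall A, S A -> A \in H.
have exP : exists d, `[< exists2 H, P H & \dim H = d >].
  exists (\dim (fullv : {vspace 'End(L)})); apply/asboolP.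
  by exists fullv => //; split=> [A B|A] *; rewrite memvf.
have [d /asboolP[H [Hsub HS] dH] dmin] := ex_minnP exP.
apply: (xgetPex _ (ex_intro _ H _)); split=> // H' H'sub H'S.
suff eqH : (H :&: H' = H)%VS by rewrite -eqH capvSr.
apply/eqP; rewrite eqEdim capvSl dH; apply: dmin; apply/asboolP.
exists (H :&: H')%VS => //; split=> [A B|A SA]; last first.
  by rewrite memv_cap HS ?H'S.
rewrite !memv_cap => /andP[? ?] /andP[? ?].
by rewrite Hsub ?H'sub.
Qed.

(* Left-invariant tensors with values in the endomorphisms of the tangent     *)
(* bundle, and their covariant derivative                                     *)
(* (D T)(z, x_0, .., x_(p-1)) =                                               *)
(*   [D_z, T(x_0, ..)] - sum_i T(x_0, .., D_z x_i, .., x_(p-1)).              *)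
Definition end_tensor (p : nat) := {ffun 'I_p -> L} -> 'End(L).

Variable D : 'Hom(L, 'End(L)).

Definition cov_deriv p (T : end_tensor p) : end_tensor p.+1 := fun x =>
  let z := x ord0 in
  let y := [ffun i => x (lift ord0 i)] in
  end_br (D z) (T y) -
  \sum_(i < p) T [ffun j => if j == i then D z (y i) else y j].

Definition curvature : end_tensor 2 := fun x =>
  let u := x (inord 0) in let v := x (inord 1) in
  end_br (D u) (D v) - D (lie_br u v).

Fixpoint curvature_deriv (m : nat) : end_tensor (m + 2) :=
  if m is m'.+1 then cov_deriv (@curvature_deriv m') else curvature.

(* Lie algebra of the (restricted) holonomy group, through the Ambrose-Singer *)
(* theorem for a left-invariant connection D.                                 *)
Definition hol : {vspace 'End(L)} :=
  lie_generated [set A | exists m x, A = @curvature_deriv m x].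

End Holonomy.
Arguments curvature_deriv {R L} D m _.

(* Main.v *)
Require Import Defs.
From mathcomp Require Import all_boot all_order all_algebra.
From mathcomp Require Import all_classical all_reals.
From mathcomp Require Import ring.
Set Implicit Arguments.
Unset Strict Implicit.
Unset Printing Implicit Defensive.
Local Open Scope ring_scope.

(** For an abelian complex structure the Bismut connection has a closed
    formula.  Write the torsion as T(x,y,w) = -dF(Jx,Jy,Jw).  Each term of
    dF(Jx,Jy,Jw) contains a bracket [Ja,Jb] = [a,b] and a factor
    F([a,b],Jc) = g([a,b],J(Jc)) = -g([a,b],c), so J disappears from T
    altogether.  In the sum with the Koszul formula for the Levi-Civita
    connection, two of the three terms cancel and the third one doubles:
      g(D_x y, w) = - g([y,w], x)         (bismut_abelianE).

    In the Heisenberg case all brackets are multiples of one central vector z,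
    say [y,w] = omega(y,w) z, so that D_x = g(z,x) A for the single
    endomorphism A defined by g(Ay,w) = - omega(y,w)  (bismut_in_line).
    A connection with values in a line of endomorphisms has holonomy in that
    line: commutators vanish, which leaves R(x,y) = -D_[x,y], and covariant
    differentiation only recombines values of the tensor it is applied to.
    The line is attained because z is itself a bracket [u,v], and
    R(u,v) = -D_z is nonzero: g(D_z u, v) = -g(z,z) (dim_hol_line). *)

Import Order.TTheory GRing.Theory Num.Theory.

(** * Holonomy of a connection with values in a line *)

Section HolonomyInLine.
Variables (R : realType) (L : lieAlgebra R) (D : 'Hom(L, 'End(L))).

Lemma end_br_line (A B C : 'End(L)) :
  B \in <[A]>%VS -> C \in <[A]>%VS -> end_br B C = 0.
Proof.
move=> /vlineP[b ->] /vlineP[c ->].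
by rewrite /end_br -!comp_lfunZl -!comp_lfunZr !scalerA mulrC subrr.
Qed.

Lemma curvature_deriv_line (A : 'End(L)) :
  (forall x, D x \in <[A]>%VS) ->
  forall m x, curvature_deriv D m x \in <[A]>%VS.
Proof.
move=> DA; elim=> [|m IHm] x /=.
  by rewrite /curvature (@end_br_line A) // sub0r memvN.
rewrite /cov_deriv (@end_br_line A) // sub0r memvN.
by apply: memv_suml => i _; apply: IHm.
Qed.

(** The curvature R(u,v) = -D_[u,v] already spans the line when it is nonzero,
    and a line of endomorphisms is an abelian Lie subalgebra. *)
Lemma dim_hol_line (A : 'End(L)) (u v : L) :
  (forall x, D x \in <[A]>%VS) -> D (lie_br u v) != 0 -> \dim (hol D) = 1%N.
Proof.
move=> DA Duv0; rewrite /hol; set S : set 'End(L) := (X in lie_generated X).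
have [_ genS minS] := lie_generatedP S.
have sub : (lie_generated S <= <[A]>)%VS.
  apply: minS => [B C HB HC|B [m [x ->]]]; last exact: curvature_deriv_line.
  by rewrite (@end_br_line A) // mem0v.
have Duv : D (lie_br u v) \in lie_generated S.
  rewrite -memvN; apply: genS; exists 0, (pair_of u v).
  rewrite /= /curvature !ffunE !(tnth_nth 0) /= !inordK //=.
  by rewrite (@end_br_line A) // sub0r.
apply/eqP; rewrite eqn_leq; apply/andP; split.
  by apply: leq_trans (dimvS sub) _; rewrite dim_vline leq_b1.
by have := dimvS (Duv : (<[_]> <= _)%VS); rewrite dim_vline Duv0.
Qed.

End HolonomyInLine.

(** * The Bismut connection of an abelian Hermitian structure *)

Section BismutAbelian.
Variables (R : realType) (L : lieAlgebra R).
Variables (J : 'End(L)) (g : {dot L for idfun}).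
Implicit Types x y z w : L.

Lemma dot_inj x y : (forall w, g x w = g y w) -> x = y.
Proof.
move=> gxy; apply/eqP; rewrite -subr_eq0; apply: contraT => /neq0_dnorm_gt0.
by move/(_ _ g); rewrite linearBl /= gxy subrr ltxx.
Qed.

Lemma lie_brC x y : lie_br x y = - lie_br y x.
Proof.
have brDl a b c : lie_br (a + b) c = lie_br a c + lie_br b c :> L.
  by have := lie_linearl c 1 a b; rewrite /= !scale1r.
have brDr a b c : lie_br a (b + c) = lie_br a b + lie_br a c :> L.
  by have := lie_linearr a 1 b c; rewrite !scale1r.
apply/eqP; rewrite -addr_eq0; apply/eqP.
have := lie_alt (x + y).
by rewrite brDl !brDr !lie_alt addr0 add0r.
Qed.

Lemma fundamental_formE x y : fundamental_form J g (pair_of x y) = g x (J y).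
Proof.
by rewrite /fundamental_form !ffunE !(tnth_nth 0) /= !inordK.
Qed.

(** J cancels out of the torsion, since every bracket of J-images is the
    original bracket and F([a,b], Jc) = - g([a,b], c). *)
Lemma bismut_torsion_abelianE x y w :
    abelian_structure J ->
  bismut_torsion J g x y w =
    - g (lie_br x y) w + g (lie_br x w) y - g (lie_br y w) x.
Proof.
move=> [[JJ _] Jbr].
rewrite /bismut_torsion ce_diff2E !fundamental_formE !Jbr !JJ !linearNr /=.
by ring.
Qed.

Lemma bismut_abelianE (D : 'Hom(L, 'End(L))) :
    abelian_structure J -> bismut_connection J g D ->
  forall x y w, g (D x y) w = - g (lie_br y w) x.
Proof.
move=> Jab [D0 LC DE] x y w.
apply: (@mulfI _ 2); first by rewrite pnatr_eq0.
rewrite DE mulrDr LC mulVKf ?pnatr_eq0 // bismut_torsion_abelianE //.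
by rewrite (lie_brC w x) linearNl /=; ring.
Qed.

(** When the derived algebra is spanned by z, the formula for D reads
    D_x = (g(z,x) / g(z,z)) D_z. *)
Lemma bismut_in_line (D : 'Hom(L, 'End(L))) z :
    abelian_structure J -> bismut_connection J g D -> z != 0 ->
    (forall x y, lie_br x y \in <[z]>%VS) ->
  forall x, D x \in <[D z]>%VS.
Proof.
move=> Jab HD z0 brz x; apply/vlineP; exists (g z x / g z z).
apply/lfunP => y; apply: dot_inj => w.
have gzz : g z z != 0 by rewrite gt_eqF // neq0_dnorm_gt0.
rewrite scale_lfunE linearZl_LR /= !(bismut_abelianE Jab HD).
have /vlineP[c ->] := brz y w.
by rewrite !linearZl_LR /=; field.
Qed.

Lemma dim_hol_bismut (D : 'Hom(L, 'End(L))) u v :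
    abelian_structure J -> bismut_connection J g D -> lie_br u v != 0 :> L ->
    (forall x y, lie_br x y \in <[lie_br u v : L]>%VS) ->
  \dim (hol D) = 1%N.
Proof.
move=> Jab HD uv0 br_uv.
apply: (dim_hol_line (u := u) (v := v) (bismut_in_line Jab HD uv0 br_uv)).
apply: contraTneq (neq0_dnorm_gt0 (s := g) _ uv0) => D0.
have := bismut_abelianE Jab HD (lie_br u v) u v.
rewrite D0 zero_lfunE linear0l => /eqP; rewrite eq_sym oppr_eq0 => /eqP ->.
by rewrite ltxx.
Qed.

End BismutAbelian.

(** * The Heisenberg algebra times an abelian factor *)

Theorem proposition4p7 (R : realType) (n k : nat) (hn : (2 <= n)%N)
    (L := prod_lie (heisenberg_lie R n) (abelian_lie R k.*2.+1))
    (J : 'End(L)) (g : {dot L for idfun}) (hJg : abelian_balanced J g)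
    (D : 'Hom(L, 'End(L))) (hD : bismut_connection J g D) :
  \dim (hol D) = 1%N.
Proof.
have [_ Jab _] := hJg.
pose i0 : 'I_n := Ordinal (ltnW hn).
pose u : L := (heis_e R (heis_odd i0), 0).
pose v : L := (heis_e R (heis_even i0), 0).
have uvE : lie_br u v = (heis_z0 R n, 0) :> L.
  rewrite /= /prod_br /=; congr pair.
  by have [-> _ _] := heis_br_e R i0 i0; rewrite eqxx scale1r.
apply: (dim_hol_bismut (u := u) (v := v) Jab hD).
  rewrite uvE; apply/eqP => /(congr1 fst) /rowP /(_ ord_max).
  by rewrite !mxE !eqxx => /eqP; rewrite oner_eq0.
move=> x y; rewrite uvE; apply/vlineP.
rewrite /= /prod_br /= /heis_br; eexists.
by congr pair; rewrite scaler0.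
Qed.
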